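(* Let $H$ be a subgroup of the discrete group $G$. Then, for every $f\in \mathrm{B}(H)$, with $\widetilde f\in \mathrm{B}(G)$ the extension of $f$ by zero outside $H$, we have $$\sigma_{\mathrm{B}(H)}(f)\cup\{0\}=\sigma_{\mathrm{B}(G)}(\widetilde{f})=\sigma_{\mathrm{B}(H)}(\widetilde{f}).$$
   Context: For a discrete group $G$, $\mathrm{B}(G)$ is the Fourier--Stieltjes algebra: the linear span of positive definite functions on $G$, a commutative unital Banach algebra under pointwise multiplication with the norm of $\mathrm{B}(G)=C^{\ast}(G)^{\ast}$ (dual of the full group $C^*$-algebra). For a subgroup $H$ of $G$ and $f\in\mathrm{B}(H)$, the function $\widetilde f$ equal to $f$ on $H$ and $0$ on $G\setminus H$ belongs to $\mathrm{B}(G)$. In this way $\mathrm{B}(H)$ is regarded as the closed ideal of $\mathrm{B}(G)$ consisting of all elements vanishing outside $H$. $\sigma_{\mathrm{B}(H)}(f)$ denotes the spectrum of $f$ in the unital algebra $\mathrm{B}(H)$; $\sigma_{\mathrm{B}(G)}(\widetilde f)$ denotes the spectrum of $\widetilde f$ in $\mathrm{B}(G)$; and $\sigma_{\mathrm{B}(H)}(\widetilde f)$, for the element $\widetilde f$ of $\mathrm{B}(G)$ supported on $H$, denotes the spectrum of $\widetilde f$ in the unitisation of $\mathrm{B}(H)$ treated as an ideal of $\mathrm{B}(G)$.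
   Formalization: The equality with the spectrum of f~ in B(G) is stated only for proper subgroups H, since for H = G and f = 1 it fails ({0,1} versus {1}); the equality of σ_{B(H)}(f) ∪ {0} with the spectrum of f~ in the unitisation of B(H) is stated for every H. *)

(* Defs.v *)
From HB Require Import structures.
From mathcomp Require Import all_boot all_order all_algebra.
From mathcomp Require Import boolp classical_sets functions reals.
From mathcomp Require Import complex.

Set Implicit Arguments.
Unset Strict Implicit.
Unset Printing Implicit Defensive.

Import Order.TTheory GRing.Theory Num.Theory.
Local Open Scope ring_scope.

Section Spectrum.
Variables (K : pzRingType) (A : algType K).

Definition invertible (a : A) : Prop := exists b : A, a * b = 1 /\ b * a = 1.

Definition spectrum (a : A) : set K :=
  [set l : K | ~ invertible (a - l *: 1)]%classic.

End Spectrum.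

Section Unitization.
Variables (K : comNzRingType) (A : comAlgType K) (I : submodClosed A).

Definition nu_subalg : Type := {a : A | a \in I}.

HB.instance Definition _ := [isSub of nu_subalg for sval].
HB.instance Definition _ := [Choice of nu_subalg by <:].
HB.instance Definition _ := [SubChoice_isSubLmodule of nu_subalg by <:].

Hypothesis IM : GRing.mulr_2closed I.

Definition nu_mul (a b : nu_subalg) : nu_subalg :=
  exist _ (val a * val b) (IM (valP a) (valP b)).

(* The pair (k, a) stands for the formal sum k + a; a new unit is adjoined even
   when I already has one. *)
Definition unitization of GRing.mulr_2closed I : Type :=
  (K^o * nu_subalg)%type.

Local Notation U := (unitization IM).

HB.instance Definition _ := GRing.Lmodule.on U.

Definition unitization_mul (u v : U) : U :=
  (u.1 * v.1, (u.1 : K) *: v.2 + (v.1 : K) *: u.2 + nu_mul u.2 v.2).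

Definition unitization_one : U := (1, 0).

Let U_eq (u v : U) : u.1 = v.1 -> val u.2 = val v.2 -> u = v.
Proof.
by case: u v => [? ?] [? ?] /= -> e; congr (_, _); apply: val_inj.
Qed.

Let U_valE (u v : U) : val (unitization_mul u v).2 =
  (u.1 : K) *: val v.2 + (v.1 : K) *: val u.2 + val u.2 * val v.2.
Proof. by []. Qed.

Fact unitization_mulA : associative unitization_mul.
Proof.
move=> u v w; apply: U_eq; first exact: mulrA.
rewrite 2!U_valE [in RHS]U_valE U_valE /=.
rewrite !scalerDr !mulrDl !mulrDr !scalerA -!scalerAl -!scalerAr mulrA.
by rewrite !(mulrC w.1) [LHS](AC (4*3) (1*(2*4*6)*(3*5*7))).
Qed.

Fact unitization_mulC : commutative unitization_mul.
Proof.
move=> u v; apply: U_eq; first exact: mulrC.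
by rewrite !U_valE [_ *: _ + _ *: _]addrC [sval u.2 * _]mulrC.
Qed.

Fact unitization_mul1 : left_id unitization_one unitization_mul.
Proof.
move=> u; apply: U_eq; first exact: mul1r.
by rewrite U_valE /= scale1r scaler0 mul0r !addr0.
Qed.

Fact unitization_mulDl : left_distributive unitization_mul +%R.
Proof.
move=> u v w; apply: U_eq; first exact: mulrDl.
rewrite U_valE /= scalerDl scalerDr mulrDl.
by rewrite [LHS](AC (2*2*2) (1*3*5*(2*4*6))).
Qed.

Fact unitization_oner_neq0 : unitization_one != 0.
Proof. by apply/eqP => /(congr1 fst) /eqP; rewrite /= oner_eq0. Qed.

HB.instance Definition _ := GRing.Zmodule_isComNzRing.Build U
  unitization_mulA unitization_mulC unitization_mul1 unitization_mulDl
  unitization_oner_neq0.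

Fact unitization_scalerAl (k : K) (u v : U) : k *: (u * v) = (k *: u) * v.
Proof.
apply: U_eq; first exact: mulrA.
rewrite [LHS]/= U_valE /= !scalerDr !scalerA scalerAl.
by rewrite (mulrC k (v.1 : K)).
Qed.

HB.instance Definition _ :=
  GRing.Lmodule_isLalgebra.Build K U unitization_scalerAl.
HB.instance Definition _ := GRing.Lalgebra_isComAlgebra.Build K U.

Definition in_unitization (a : nu_subalg) : U := (0, a).

End Unitization.

Section PsdMatrix.
Variable C : numClosedFieldType.
Local Open Scope sesquilinear_scope.

Lemma psd_hermitian n (A : 'M[C]_n) :
  (forall u : 'rV[C]_n, 0 <= (u *m A *m u ^t*) 0 0) -> A ^t* = A.
Proof.
move=> A0; pose q (u v : 'rV[C]_n) := (u *m A *m v ^t*) 0 0.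
have qDl u v w : q (u + v) w = q u w + q v w by rewrite /q !mulmxDl mxE.
have qDr u v w : q w (u + v) = q w u + q w v.
  by rewrite /q linearD /= map_mxD mulmxDr mxE.
have qZl a u v : q (a *: u) v = a * q u v by rewrite /q -!scalemxAl mxE.
have qZr a u v : q u (a *: v) = a^* * q u v.
  by rewrite /q linearZ /= map_mxZ -scalemxAr mxE.
have qR u : (q u u)^* = q u u by apply/CrealP/ger0_real/A0.
have qE i j : q (delta_mx 0 i) (delta_mx 0 j) = A i j.
  by rewrite /q trmx_delta map_delta_mx -rowE -colE !mxE.
have qC u v : (q u v)^* = q v u.
  have h1 := qR (u + v); have h2 := qR (u + 'i *: v).
  rewrite !(qDl, qDr) !rmorphD /= !qR in h1.
  rewrite !(qDl, qDr, qZl, qZr) conjCi !rmorphD /= !rmorphM /= conjCi rmorphN /= conjCi !qR in h2.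
  have e1 : (q u v)^* + (q v u)^* = q u v + q v u.
    by apply: (addrI (q u u)); apply: (addIr (q v v)); move: h1; rewrite !addrA.
  have e2 : 'i * ((q u v)^* - (q v u)^*) = 'i * (q v u - q u v).
    have : 'i * (q u v)^* - 'i * (q v u)^* = 'i * q v u - 'i * q u v.
      apply: (addrI (q u u)); apply: (addIr ('i * - 'i * q v v));  move: h2.
      rewrite ?(rmorphN,rmorphM,conjCi,mulrN,mulNr) /= !opprK !mulrA => h2.
      rewrite [LHS](AC (1*2*1) (1*2*(3*4)))/= h2.
      by rewrite [RHS](AC (1*2*1) (1*3*(2*4))).
    by rewrite !mulrBr.
  have e3 := mulfI (neq0Ci _) e2.
  apply: (@mulfI _ 2); first by rewrite pnatr_eq0.
  have := congr2 +%R e1 e3; rewrite addrACA subrr addr0 [q u v + _]addrC addrACA subrr addr0.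
  by rewrite !mulr_natl !mulr2n.
by apply/matrixP=> i j; rewrite !mxE -!qE qC.
Qed.
Lemma psd_spectral n (A : 'M[C]_n) :
  (forall u : 'rV[C]_n, 0 <= (u *m A *m u ^t*) 0 0) ->
  exists (d : 'rV[C]_n) (P : 'M[C]_n), (forall k, 0 <= d 0 k) /\
    forall i j, A i j = \sum_k d 0 k * ((P k i)^* * P k j).
Proof.
move=> A0; have Aherm := psd_hermitian A0.
have /orthomx_spectralP Adiag : A \is normalmx by apply/normalmxP; rewrite Aherm.
set P := spectralmx A in Adiag; set d := spectral_diag A in Adiag.
have Pu : P \is unitarymx by exact: spectral_unitarymx.
rewrite invmx_unitary // in Adiag.
have PP : P *m P ^t* = 1%:M by apply/unitarymxP.
exists d, P; split=> [k|i j].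
  suff -> : d 0 k = (row k P *m A *m (row k P) ^t*) 0 0 by exact: A0.
  have dE : diag_mx d = P *m A *m P ^t*.
    by rewrite Adiag !mulmxA PP mul1mx -mulmxA PP mulmx1.
  have -> : d 0 k = diag_mx d k k by rewrite mxE eqxx.
  rewrite dE [LHS]mxE [RHS]mxE; apply: eq_bigr => l _; rewrite !mxE.
  by congr (_ * _); apply: eq_bigr => m _; rewrite !mxE.
rewrite {1}Adiag -mulmxA mxE; apply: eq_bigr => k _.
by rewrite mul_diag_mx !mxE mulrCA.
Qed.

End PsdMatrix.

Section PositiveDefinite.
Variables (C : numClosedFieldType) (G : groupType).
Implicit Types p q : G -> C.

Definition positive_definite p : Prop :=
  forall (n : nat) (x : 'I_n -> G) (c : 'I_n -> C),
    0 <= \sum_(i < n) \sum_(j < n) c i * (c j)^* * p ((x j)^-1 * x i)%g.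

Lemma positive_definite1 : positive_definite (fun=> 1).
Proof.
move=> n x c; suff -> : \sum_(i < n) \sum_(j < n) c i * (c j)^* * 1 =
    (\sum_(i < n) c i) * (\sum_(i < n) c i)^* by exact: mul_conjC_ge0.
rewrite mulr_suml; apply: eq_bigr => i _; rewrite rmorph_sum mulr_sumr.
by apply: eq_bigr => j _; rewrite mulr1.
Qed.

Local Open Scope sesquilinear_scope.

(* Schur product theorem *)
Lemma positive_definiteM p q : positive_definite p -> positive_definite q ->
  positive_definite (fun g => p g * q g).
Proof.
move=> p0 q0 n x c; pose A : 'M[C]_n := \matrix_(i, j) p ((x j)^-1 * x i)%g.
have [|d [P [d0 AE]]] := @psd_spectral _ _ A.
  move=> u; suff -> : (u *m A *m u ^t*) 0 0 =
    \sum_(i < n) \sum_(j < n) u 0 i * (u 0 j)^* * p ((x j)^-1 * x i)%g by exact: p0.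
  rewrite mxE exchange_big; apply: eq_bigr => j _ /=.
  rewrite mxE mulr_suml; apply: eq_bigr => i _.
  by rewrite !mxE mulrAC.
suff -> : \sum_(i < n) \sum_(j < n)
      c i * (c j)^* * (p ((x j)^-1 * x i)%g * q ((x j)^-1 * x i)%g) =
    \sum_k d 0 k * \sum_(i < n) \sum_(j < n)
      (c i * (P k i)^*) * (c j * (P k j)^*)^* * q ((x j)^-1 * x i)%g.
  by apply: sumr_ge0 => k _; apply: mulr_ge0 => //; apply: q0.
under [RHS]eq_bigr do rewrite mulr_sumr; rewrite [RHS]exchange_big.
apply: eq_bigr => i _ /=.
under [RHS]eq_bigr do rewrite mulr_sumr; rewrite [RHS]exchange_big.
apply: eq_bigr => j _ /=.
have -> : p ((x j)^-1 * x i)%g = A i j by rewrite mxE.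
rewrite AE mulr_suml mulr_sumr; apply: eq_bigr => k _.
rewrite rmorphM /= conjCK.
move: (q _) ((c j)^*) ((P k i)^*) => Q cj Pi.
by rewrite (AC (2*(1*2*1)) (3*((1*4)*(2*5)*6))).
Qed.

End PositiveDefinite.

Section Subgroup.
Variables (G : groupType) (H : groupClosed G).

Definition subgroup : Type := {x : G | x \in H}.

HB.instance Definition _ := [isSub of subgroup for sval].
HB.instance Definition _ := [Choice of subgroup by <:].

Fact subgroup_closed : group_closed (fun x => x \in H).
Proof. by split; [exact: gpred1 | exact: gpredF]. Qed.

HB.instance Definition _ :=
  SubChoice_isSubGroup.Build G _ subgroup subgroup_closed.

Variable C : numClosedFieldType.

Definition zero_ext (f : subgroup -> C) : G -> C :=
  fun x => oapp f 0 (insub x).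

Lemma zero_ext_val f (h : subgroup) : zero_ext f (val h) = f h.
Proof. by rewrite /zero_ext valK. Qed.

Lemma zero_ext_out f x : x \notin H -> zero_ext f x = 0.
Proof. by move=> xH; rewrite /zero_ext insubN. Qed.

Lemma positive_definite_zero_ext p :
  positive_definite p -> positive_definite (zero_ext p).
Proof.
move=> p0 n x c.
pose e (i k : 'I_n) := ((x k)^-1 * x i)%g \in H.
have exx i : e i i by rewrite /e mulVg gpred1.
have esym i k : e i k = e k i by rewrite /e -gpredV invgM invgK.
have etr j i k : e i j -> e j k -> e i k.
  rewrite /e => ij jk; have := gpredM _ _ jk ij.
  by rewrite -mulgA mulVKg.
pose r i := odflt i [pick k | e i k].
have er i : e i (r i) by rewrite /r; case: pickP => //=.
have rP i j : e i j -> r i = r j.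
  move=> ij; have eij k : e i k = e j k.
    by apply/idP/idP; apply: etr; rewrite // esym.
  by rewrite /r (eq_pick eij); case: pickP => // /(_ j); rewrite exx.
pose h k i : subgroup := insubd (1%g : subgroup) ((x k)^-1 * x i)%g.
pose c' k i := if r i == k then c i else 0.
suff -> : \sum_(i < n) \sum_(j < n)
      c i * (c j)^* * zero_ext p ((x j)^-1 * x i)%g =
    \sum_k \sum_(i < n) \sum_(j < n)
      c' k i * (c' k j)^* * p ((h k j)^-1 * h k i)%g.
  by apply: sumr_ge0 => k _; apply: p0.
rewrite [RHS]exchange_big; apply: eq_bigr => i _ /=.
rewrite [RHS]exchange_big; apply: eq_bigr => j _ /=.
rewrite (bigD1 (r i)) //= big1 ?addr0 => [|k]; last first.
  by rewrite eq_sym /c' => /negPf ->; rewrite !mul0r.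
rewrite /c' eqxx; have [rji|rji] := eqVneq (r j) (r i).
  congr (_ * _); rewrite -zero_ext_val; congr (zero_ext p _).
  rewrite gmulfM gmulfV /= !val_insubd -rji.
  have -> : ((x (r j))^-1 * x j)%g \in H := er j.
  have -> : ((x (r j))^-1 * x i)%g \in H by rewrite rji; exact: er.
  by rewrite invgM invgK -mulgA mulVKg.
rewrite zero_ext_out ?mulr0 ?rmorph0 ?mulr0 ?mul0r //.
by apply: contra rji => /rP ->.
Qed.

End Subgroup.

Section FourierStieltjes.
Variables (C : numClosedFieldType) (G : groupType).
Implicit Types f g : G -> C.

(* The linear span of the positive definite functions. Its dual-space norm is
   not recorded: invertibility, hence the spectrum, is purely algebraic. *)
Definition is_fourier_stieltjes : {pred G -> C} := fun f =>
  `[< exists (n : nat) (a : 'I_n -> C) (p : 'I_n -> G -> C),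
      (forall i, positive_definite (p i)) /\
      f = (fun x => \sum_(i < n) a i * p i x) >].

Lemma is_fsP f : reflect
    (exists (n : nat) (a : 'I_n -> C) (p : 'I_n -> G -> C),
      (forall i, positive_definite (p i)) /\
      f = (fun x => \sum_(i < n) a i * p i x)) (f \in is_fourier_stieltjes).
Proof. exact: asboolP. Qed.

Lemma is_fs_pd p : positive_definite p -> p \in is_fourier_stieltjes.
Proof.
move=> p0; apply/is_fsP; exists 1%N, (fun=> 1), (fun=> p); split=> //.
by apply/funext => x; rewrite big_ord1 mul1r.
Qed.

Lemma is_fsD f g : f \in is_fourier_stieltjes -> g \in is_fourier_stieltjes ->
  f + g \in is_fourier_stieltjes.
Proof.
move=> /is_fsP[n [a [p [p0 ->]]]] /is_fsP[m [b [q [q0 ->]]]]; apply/is_fsP.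
exists (n + m)%N, (fun i => match fintype.split i with inl i => a i | inr i => b i end),
 (fun i => match fintype.split i with inl i => p i | inr i => q i end).
split=> [i|]; first by case: fintype.split.
apply/funext => x; rewrite big_split_ord; congr (_ + _); apply: eq_bigr => i _.
  by rewrite (unsplitK (inl i)).
by rewrite (unsplitK (inr i)).
Qed.

Lemma is_fsZ k f : f \in is_fourier_stieltjes ->
  (fun x => k * f x) \in is_fourier_stieltjes.
Proof.
move=> /is_fsP[n [a [p [p0 ->]]]]; apply/is_fsP.
exists n, (fun i => k * a i), p; split=> //; apply/funext=> x.
by rewrite mulr_sumr; apply: eq_bigr => i _; rewrite mulrA.
Qed.

Lemma is_fs_sum n (F : 'I_n -> G -> C) :
  (forall i, F i \in is_fourier_stieltjes) ->
  (fun x => \sum_(i < n) F i x) \in is_fourier_stieltjes.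
Proof.
move=> F0; rewrite -fct_sumE; elim/big_ind: _ => //; last exact: is_fsD.
apply/is_fsP; exists 0%N, (fun=> 0), (fun=> 0); split=> [[]//|].
by apply/funext => x; rewrite big_ord0.
Qed.

Lemma is_fsM f g : f \in is_fourier_stieltjes -> g \in is_fourier_stieltjes ->
  f * g \in is_fourier_stieltjes.
Proof.
move=> /is_fsP[n [a [p [p0 ->]]]] /is_fsP[m [b [q [q0 ->]]]].
rewrite (_ : _ * _ = fun x => \sum_(i < n) a i * \sum_(j < m) b j * (p i x * q j x)).
  do 2![apply: is_fs_sum => ?; apply: is_fsZ].
  exact/is_fs_pd/positive_definiteM.
apply/funext => x; rewrite [LHS]mulr_suml; apply: eq_bigr => i _.
by rewrite -mulrA; congr (_ * _); rewrite mulr_sumr; apply: eq_bigr => j _;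
  rewrite mulrCA.
Qed.

Fact is_fs_subring_closed : GRing.subring_closed is_fourier_stieltjes.
Proof.
split; [exact/is_fs_pd/positive_definite1 | | exact: is_fsM].
move=> f g fs gs; apply: is_fsD => //.
rewrite (_ : - g = fun x => -1 * g x); first exact: is_fsZ.
by apply/funext => x; rewrite mulN1r.
Qed.

Record fourier_stieltjes := FourierStieltjes {
  fs_fun :> G -> C;
  fs_funP : fs_fun \in is_fourier_stieltjes
}.

HB.instance Definition _ := [isSub for fs_fun].
HB.instance Definition _ := [Choice of fourier_stieltjes by <:].
HB.instance Definition _ := GRing.SubChoice_isSubComPzRing.Build
  _ _ fourier_stieltjes is_fs_subring_closed.

Fact fs_oner_neq0 : 1 != 0 :> fourier_stieltjes.
Proof.
apply/eqP => /(congr1 (fun f : fourier_stieltjes => f 1%g)) /eqP.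
by rewrite /= oner_eq0.
Qed.
HB.instance Definition _ :=
  GRing.PzSemiRing_isNonZero.Build fourier_stieltjes fs_oner_neq0.

Definition fs_scale (k : C) (f : fourier_stieltjes) : fourier_stieltjes :=
  FourierStieltjes (is_fsZ k (fs_funP f)).

Lemma fsP (f g : fourier_stieltjes) : (forall x, f x = g x) -> f = g.
Proof. by move=> fg; apply/val_inj/funext. Qed.

Fact fs_scaleA a b (f : fourier_stieltjes) : fs_scale a (fs_scale b f) = fs_scale (a * b) f.
Proof. by apply: fsP => x; exact: mulrA. Qed.
Fact fs_scale1 : left_id 1 fs_scale.
Proof. by move=> f; apply: fsP => x; exact: mul1r. Qed.
Fact fs_scaleDr : right_distributive fs_scale +%R.
Proof. by move=> k f g; apply: fsP => x; exact: mulrDr. Qed.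
Fact fs_scaleDl (f : fourier_stieltjes) : {morph fs_scale^~ f : a b / a + b}.
Proof. by move=> a b; apply: fsP => x; exact: mulrDl. Qed.
HB.instance Definition _ := GRing.Zmodule_isLmodule.Build C fourier_stieltjes
  fs_scaleA fs_scale1 fs_scaleDr fs_scaleDl.

Fact fs_scaleAl k (f g : fourier_stieltjes) : k *: (f * g) = (k *: f) * g.
Proof. by apply: fsP => x; exact: mulrA. Qed.
HB.instance Definition _ :=
  GRing.Lmodule_isLalgebra.Build C fourier_stieltjes fs_scaleAl.
HB.instance Definition _ :=
  GRing.Lalgebra_isComAlgebra.Build C fourier_stieltjes.

End FourierStieltjes.

Notation "''B' [ C ] ( G )" := (fourier_stieltjes C G)
  (at level 8, format "''B' [ C ] ( G )") : type_scope.

Section Extension.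
Variables (C : numClosedFieldType) (G : groupType) (H : groupClosed G).

Lemma is_fs_zero_ext (f : 'B[C](subgroup H)) :
  zero_ext f \in @is_fourier_stieltjes C G.
Proof.
have /is_fsP[n [a [p [p0 fE]]]] := fs_funP f.
rewrite (_ : zero_ext f = fun x => \sum_(i < n) a i * zero_ext (p i) x).
  by apply: is_fs_sum => i; apply/is_fsZ/is_fs_pd/positive_definite_zero_ext.
apply/funext => x; have [xH|xH] := boolP (x \in H).
  rewrite -[x]/(val (exist _ x xH : subgroup H)) zero_ext_val fE.
  by apply: eq_bigr => i _; rewrite zero_ext_val.
by rewrite zero_ext_out// big1// => i _; rewrite zero_ext_out// mulr0.
Qed.

Definition fs_ext (f : 'B[C](subgroup H)) : 'B[C](G) :=
  FourierStieltjes (is_fs_zero_ext f).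

Definition vanishing_outside : {pred 'B[C](G)} :=
  fun f => `[< forall x, x \notin H -> f x = 0 >].

Fact vanishing_outside_submod : GRing.submod_closed vanishing_outside.
Proof.
split=> [|k f g /asboolP f0 /asboolP g0]; apply/asboolP => // x xH.
rewrite -[LHS]/((k * f x)%R + g x) f0// g0// mulr0; exact: addr0.
Qed.

HB.instance Definition _ :=
  GRing.isSubmodClosed.Build C 'B[C](G) vanishing_outside
    vanishing_outside_submod.

Lemma vanishing_outside_ideal (f g : 'B[C](G)) :
  g \in vanishing_outside -> f * g \in vanishing_outside.
Proof.
move=> /asboolP g0; apply/asboolP => x xH.
by rewrite -[LHS]/(f x * g x) g0//; exact: mulr0.
Qed.

Fact vanishing_outsideM : GRing.mulr_2closed vanishing_outside.
Proof. by move=> f g _; exact: vanishing_outside_ideal. Qed.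

Fact fs_ext_vanishing (f : 'B[C](subgroup H)) : fs_ext f \in vanishing_outside.
Proof. by apply/asboolP => x xH; exact: zero_ext_out. Qed.

Definition fs_ext_ideal (f : 'B[C](subgroup H)) :
    unitization vanishing_outsideM :=
  in_unitization _ (exist _ (fs_ext f) (fs_ext_vanishing f)).

End Extension.

(* Main.v *)
Require Import Defs.
From mathcomp Require Import all_boot all_order all_algebra.
From mathcomp Require Import boolp classical_sets reals complex.
From mathcomp Require Import ring.

(** For [l <> 0], if [g] inverts [f - l] on [H], then the extension by zero of
    [g + 1/l], minus [1/l], inverts [fs_ext f - l] on [G]: off [H] the product
    is [(- l) * (- 1/l)].  Conversely an inverse over [G] restricts to one
    over [H].  The value [0] always lies in the two right-hand spectra since
    [fs_ext f] vanishes off [H] and has scalar part [0] in the unitization. *)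

Set Implicit Arguments.
Unset Strict Implicit.
Unset Printing Implicit Defensive.

Import GRing.Theory.

Local Open Scope ring_scope.
Local Open Scope complex_scope.
Local Open Scope classical_set_scope.

Section Restriction.
Variables (C : numClosedFieldType) (G : groupType) (H : groupClosed G).

(** The inclusion [val] is a group morphism, so a tuple in [H] gives the same sum as its image in
    [G]. *)
Lemma positive_definite_val (p : G -> C) :
  positive_definite p -> positive_definite (p \o (val : subgroup H -> G)).
Proof. by move=> p0 n x c; exact: (p0 n (val \o x) c). Qed.

Lemma is_fs_val (f : 'B[C](G)) :
  (f : G -> C) \o (val : subgroup H -> G) \in @is_fourier_stieltjes C _.
Proof.
have /is_fsP[n [a [p [p0 fE]]]] := fs_funP f.
apply/is_fsP; exists n, a, (fun i => p i \o val); split=> [i|].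
  exact: positive_definite_val.
by apply/funext => x; rewrite /= fE.
Qed.

Definition fs_res (f : 'B[C](G)) : 'B[C](subgroup H) :=
  FourierStieltjes (is_fs_val f).

End Restriction.

Section Invertibility.
Variables (C : numClosedFieldType) (G : groupType).

Lemma fs_sub_scalarE (f : 'B[C](G)) (l : C) x : (f - l *: 1) x = f x - l.
Proof. by rewrite -[LHS]/(f x - l * 1) mulr1. Qed.

(** Products are pointwise and commutative, so one pointwise identity suffices; the inverse must
    still be a Fourier-Stieltjes function. *)
Lemma invertible_fsP (f : 'B[C](G)) :
  invertible f <-> exists g : 'B[C](G), forall x, f x * g x = 1.
Proof.
split=> [[g [fg _]]|[g fg]]; exists g.
  by move=> x; exact: (congr1 (fun h : 'B[C](G) => h x) fg).
by rewrite mulrC; split; apply: fsP => x; rewrite -[RHS](fg x)//; exact: mulrC.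
Qed.

Variable H : groupClosed G.
Local Notation U := (unitization (@vanishing_outsideM C G H)).

(** The maps sending [(k, a)] to [k] and to [k + a x] are multiplicative and together separate
    points. The scalar equation is separate because no [x] yields it when [H] is all of [G]. *)
Lemma invertible_unitizationP (u : U) :
  invertible u <-> exists v : U, (u.1 : C) * v.1 = 1 /\
    forall x, (u.1 + val u.2 x) * (v.1 + val v.2 x) = 1 :> C.
Proof.
have evalM (v : U) x : (u.1 + val u.2 x) * (v.1 + val v.2 x) =
    (u * v).1 + val (u * v).2 x :> C.
  have -> : (u * v).1 = (u.1 : C) * v.1 by [].
  have -> : val (u * v).2 = (u.1 : C) *: val v.2 + (v.1 : C) *: val u.2 +
    val u.2 * val v.2 by exact: (erefl (val (unitization_mul u v).2)).
  rewrite -[(_ + _ : 'B[C](G)) x]/((u.1 : C) * val v.2 x + (v.1 : C) * val u.2 x +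
    val u.2 x * val v.2 x).
  by ring.
split=> [[v [uv _]]|[v [uv1 uvx]]]; exists v.
  split=> [|x]; first exact: (congr1 fst uv).
  by rewrite evalM uv; exact: addr0.
suff uv : u * v = 1 by split=> //; rewrite mulrC.
have e1 : (u * v).1 = 1 by exact: uv1.
rewrite [LHS]surjective_pairing e1; congr (_, _); apply/val_inj/fsP => x.
(* Cancelling the scalar part [1] leaves the function part zero at [x]. *)
by have := uvx x; rewrite evalM e1 -[X in _ = X -> _]addr0 => /addrI.
Qed.

End Invertibility.

Section SpectrumExtension.
Variables (C : numClosedFieldType) (G : groupType) (H : groupClosed G).
Variable f : 'B[C](subgroup H).

(** Stated pointwise to serve both algebras: [- l^-1] becomes a constant function over [G] and the
    scalar part in the unitization. *)
Lemma fs_ext_inverse (g : 'B[C](subgroup H)) (l : C) : l != 0 ->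
  (forall h, (f h - l) * g h = 1) ->
  forall x, (fs_ext f x - l) * (fs_ext (g + l^-1 *: 1) x - l^-1) = 1.
Proof.
move=> l0 fg x; rewrite /=; have [xH|xH] := boolP (x \in H).
  rewrite -[x]/(val (exist _ x xH : subgroup H)) !zero_ext_val.
  by rewrite -[X in _ * (X - _)]/(g _ + l^-1 * 1) mulr1 addrK.
by rewrite !zero_ext_out // !sub0r mulrNN divff.
Qed.

Lemma invertible_fs_ext (l : C) : l != 0 ->
  invertible (fs_ext f - l *: 1) <-> invertible (f - l *: 1).
Proof.
move=> l0; split=> /invertible_fsP[g fg]; apply/invertible_fsP.
  exists (fs_res H g) => h; have := fg (val h).
  by rewrite !fs_sub_scalarE /= zero_ext_val.
exists (fs_ext (g + l^-1 *: 1) - l^-1 *: 1) => x; rewrite !fs_sub_scalarE.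
by apply: fs_ext_inverse => // h; rewrite -fs_sub_scalarE.
Qed.

(** The adjoined unit is [(1, 0)], so subtracting [l *: 1] changes only the scalar part. *)
Lemma fs_ext_ideal_sub_scalarE (l : C) :
  ((fs_ext_ideal f - l *: 1).1 = - l) *
  (forall x, val (fs_ext_ideal f - l *: 1).2 x = fs_ext f x).
Proof.
split=> [|x]; first by rewrite -[LHS]/(0 - l * 1) mulr1 sub0r.
by rewrite -[LHS]/(fs_ext f x - l * 0) mulr0 subr0.
Qed.

Lemma invertible_fs_ext_ideal (l : C) : l != 0 ->
  invertible (fs_ext_ideal f - l *: 1) <-> invertible (f - l *: 1).
Proof.
move=> l0; split=> [/invertible_unitizationP[v [_ fv]]|].
  (* The witness is the image of [v] under the map of the unitization into functions on [G],
     [(k, a)] going to [k + a], then restricted to [H]. *)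
  apply/invertible_fsP; exists (fs_res H (v.1 *: 1 + val v.2)) => h.
  have := fv (val h); rewrite !fs_ext_ideal_sub_scalarE fs_sub_scalarE.
  rewrite -[X in _ -> _ * X = _]/((v.1 : C) * 1 + val v.2 (val h)) mulr1.
  by rewrite /= zero_ext_val addrC.
move=> /invertible_fsP[g fg]; apply/invertible_unitizationP.
pose v : unitization (@vanishing_outsideM C G H) :=
  (- l^-1, (fs_ext_ideal (g + l^-1 *: 1)).2).
exists v; split=> [|x]; rewrite !fs_ext_ideal_sub_scalarE; first by rewrite mulrNN divff.
rewrite addrC [X in _ * X]addrC.
by apply: fs_ext_inverse => // h; rewrite -fs_sub_scalarE.
Qed.

Lemma fs_ext_not_invertible x : x \notin H -> ~ invertible (fs_ext f).
Proof.
move=> xH /invertible_fsP[g /(_ x)] /eqP.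
by rewrite /= zero_ext_out // mul0r eq_sym oner_eq0.
Qed.

Lemma fs_ext_ideal_not_invertible : ~ invertible (fs_ext_ideal f).
Proof.
move=> /invertible_unitizationP[v [/eqP + _]].
by rewrite /= mul0r eq_sym oner_eq0.
Qed.

End SpectrumExtension.

Lemma spectrum_setU0 (K : pzRingType) (A B : algType K) (a : A) (b : B) :
  ~ invertible b ->
  (forall l : K, l != 0 -> invertible (b - l *: 1) <-> invertible (a - l *: 1)) ->
  spectrum a `|` [set 0] = spectrum b.
Proof.
move=> b0 ab; apply/seteqP; split=> l; rewrite /spectrum /=.
  have [->|l0] := eqVneq l 0; first by move=> _; rewrite scale0r subr0.
  by case=> [al|l00]; [move=> /(ab l l0) | rewrite l00 eqxx in l0].
have [->|l0] := eqVneq l 0; first by right.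
by move=> bl; left => /(ab l l0).
Qed.

(** When [H] is all of [G] and [f = 1], the value [0] is not in [spectrum (fs_ext f)]; hence the
    point off [H] in the first equality. *)
Theorem proposition2p2 (R : realType) (G : groupType) (H : groupClosed G)
    (f : 'B[R[i]](subgroup H)) :
  ((exists x : G, x \notin H) ->
     spectrum f `|` [set 0] = spectrum (fs_ext f)) /\
  spectrum f `|` [set 0] = spectrum (fs_ext_ideal f).
Proof.
split=> [[x xH]|]; apply: spectrum_setU0.
- exact: fs_ext_not_invertible xH.
- exact: invertible_fs_ext.
- exact: fs_ext_ideal_not_invertible.
- exact: invertible_fs_ext_ideal.
Qed.
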